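(* Let $X$ and $Y$ be independent identically distributed random variables taking non-negative integer values, and let $p\in(0,1)$ be fixed. Let $\varepsilon(p)$ be a Bernoulli random variable with parameter $p$, independent of the pair $(X,Y)$. Let $\{\varepsilon_j(1-p),\ j=1,2,\ldots\}$ be a sequence of independent identically distributed Bernoulli random variables with parameter $1-p$, independent of $X,Y,\varepsilon(p)$. Put $$\widetilde{X}_{1-p}=\sum_{j=1}^{X}\varepsilon_j(1-p),\qquad \widetilde{X}_{p}=\sum_{j=1}^{X}\bigl(1-\varepsilon_j(1-p)\bigr),$$ $$L_1=\widetilde{X}_{1-p}+\varepsilon(p)\,Y,\qquad L_2=\widetilde{X}_{p}+\bigl(1-\varepsilon(p)\bigr)Y.$$ Then the forms $L_1$ and $L_2$ are stochastically independent if and only if $X$ has a geometric distribution.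
   Context: A Bernoulli random variable with parameter $r$ takes the value $1$ with probability $r$ and the value $0$ with probability $1-r$. A sum $\sum_{j=1}^{0}$ is $0$. ''Geometric distribution'' means the distribution on $\{0,1,2,\ldots\}$ with probability generating function $\mathbb{E}(z^X)=\frac{a-1}{a-z}$ for some $a>1$, that is, $\Pr(X=k)=\frac{a-1}{a}\,a^{-k}$ for $k=0,1,2,\ldots$.
   Formalization: It is additionally assumed that X is not almost surely 0; if X = Y = 0 almost surely, then L_1 = L_2 = 0 are independent although X has no geometric distribution with a finite a > 1, so the equivalence fails exactly there. *)

(* Defs.v *)
From HB Require Import structures.
From mathcomp Require Export all_boot all_order all_algebra finmap.
From mathcomp Require Export all_classical all_reals all_analysis.

Set Implicit Arguments.
Unset Strict Implicit.
Unset Printing Implicit Defensive.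

Import Order.TTheory GRing.Theory Num.Theory.
Local Open Scope classical_set_scope.
Local Open Scope ring_scope.

Section independence.
Context d (T : measurableType d) (R : realType) (P : probability T R).
Local Open Scope ereal_scope.

Definition indep_systems (G H : set (set T)) : Prop :=
  forall A B, G A -> H B -> P (A `&` B) = P A * P B.

Definition indep_rv d1 d2 (T1 : measurableType d1) (T2 : measurableType d2)
    (X : T -> T1) (Y : T -> T2) : Prop :=
  indep_systems (g_sigma_algebra_preimage X) (g_sigma_algebra_preimage Y).

(* The sigma-algebra generated by a sequence of random variables, i.e. by the
   sequence regarded as one random element of the product space. *)
Definition sigma_sequence d1 (T1 : measurableType d1) (X : nat -> T -> T1) :
    set (set T) :=
  <<s \bigcup_j g_sigma_algebra_preimage (X j) >>.

(* Mutual independence: the product rule for every finite subfamily. *)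
Definition indep_sequence d1 (T1 : measurableType d1) (X : nat -> T -> T1) :
    Prop :=
  forall (J : {fset nat}) (A : nat -> set T1),
    (forall j, measurable (A j)) ->
    P (\bigcap_(j in [set` J]) (X j @^-1` A j)) =
    \prod_(j <- J) P (X j @^-1` A j).

End independence.

Section distributions.
Context d (T : measurableType d) (R : realType) (P : probability T R).

Definition identically_distributed d1 (T1 : measurableType d1)
    (X Y : {RV P >-> T1}) : Prop :=
  distribution P X =1 distribution P Y.

Definition is_bernoulli (r : R) (e : {RV P >-> bool}) : Prop :=
  distribution P e =1 bernoulli_prob r.

(* The law with probability generating function (a - 1) / (a - z). *)
Definition is_geometric (X : {RV P >-> nat}) : Prop :=
  exists2 a : R, 1 < a &
    forall k : nat, distribution P X [set k] = ((a - 1) / a * a ^- k)%:E.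

End distributions.

Section forms.
Context {T : Type}.
Variables (X Y : T -> nat) (e : T -> bool) (es : nat -> T -> bool).

(* The sequence es is indexed from 0, so the first X of its terms are the
   es j with j < X.  Booleans are read as the numbers 0 and 1. *)
Definition thin_success (t : T) : nat := (\sum_(j < X t) es j t)%N.

Definition thin_failure (t : T) : nat := (\sum_(j < X t) (1 - es j t))%N.

Definition form1 (t : T) : nat := (thin_success t + e t * Y t)%N.

Definition form2 (t : T) : nat := (thin_failure t + (1 - e t) * Y t)%N.

End forms.

(* Main.v *)
(** Let [M i j] be the joint mass of [(L1, L2)] and [f] the mass function of [X].
    Given [X = i + j], thinning leaves [(i, j)] with probability
    [b i j = 'C(i + j, i) (1 - p)^i p^j], so [M] is the mixture, with weights [p]
    and [1 - p], of the convolutions of [f (i + j) b i j] with [f] in the first and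
    in the second coordinate.

    For [f k = c r^k] the power [r^(i + j)] factors out of [M i j], and what is left
    is the probability that a Bernoulli walk reaches [i + 1] successes or [j + 1]
    failures, i.e. 1; hence [M i j = f i f j].

    Conversely, independence means that [M] has rank one.  If [f 0] vanished, a mass
    point [m] would give [M 0 0 = 0] but [M (2m) 0, M 0 (2m) > 0], a contradiction.
    If [f 0 <> 0], the minors on rows 0 and 1 determine [f (n + 1)] from
    [f 0, ..., f n] for [n >= 1]; since the geometric sequence with the same first
    two terms satisfies the same equations, it is [f]. *)
Require Import Defs.
From mathcomp Require Import zify ring.
Set Implicit Arguments.
Unset Strict Implicit.
Unset Printing Implicit Defensive.
Import Order.TTheory GRing.Theory Num.Theory.
Import numFieldNormedType.Exports.
Local Open Scope classical_set_scope.
Local Open Scope ring_scope.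

(** * The joint mass function of the two forms *)

Section mass.
Context {F : fieldType} (p : F).
Let q := 1 - p.

Definition split_mass (i j : nat) : F := 'C(i + j, i)%:R * q ^+ i * p ^+ j.

Definition forms_mass (f : nat -> F) (i j : nat) : F :=
  p * (\sum_(k < i.+1) f k * f (i - k + j)%N * split_mass (i - k) j) +
  q * (\sum_(k < j.+1) f k * f (i + (j - k))%N * split_mass i (j - k)).

Lemma split_mass0 j : split_mass 0 j = p ^+ j.
Proof. by rewrite /split_mass bin0 expr0 !mul1r. Qed.

Lemma split_massS0 i : split_mass i.+1 0 = q * split_mass i 0.
Proof. by rewrite /split_mass !addn0 !binn exprS; ring. Qed.

(** Pascal's rule, which amounts to conditioning on the outcome of the last trial. *)
Lemma split_massSS i j :
  split_mass i.+1 j.+1 = q * split_mass i j.+1 + p * split_mass i.+1 j.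
Proof.
by rewrite /split_mass addSn binS addnS addSn natrD !exprS; ring.
Qed.

Lemma sum_rev (f : nat -> F) n :
  \sum_(k < n.+1) f (n - k)%N = \sum_(k < n.+1) f k.
Proof.
rewrite (reindex_inj rev_ord_inj); apply: eq_bigr => k _ /=.
by rewrite subSS subKn // -ltnS.
Qed.

Lemma split_mass_race i j :
  p * (\sum_(k < i.+1) split_mass (i - k) j) +
  q * (\sum_(k < j.+1) split_mass i (j - k)) = 1.
Proof.
rewrite (sum_rev (split_mass ^~ j)) (sum_rev (split_mass i)).
elim: i => [|i IHi].
  rewrite big_ord1 split_mass0.
  under eq_bigr do rewrite split_mass0.
  elim: j => [|j IHj]; first by rewrite big_ord1 !expr0 /q; ring.
  by rewrite big_ord_recr mulrDr -[RHS]IHj exprS /q /=; ring.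
rewrite big_ord_recr mulrDr /= -{}IHi -addrA; congr (_ + _).
(* What is left after cancellation: a walk that makes success [i.+1] with at most [j] failures then
   leaves level [i.+1] either by failure [j.+1] or by one more success. *)
elim: j => [|j IHj]; first by rewrite !big_ord1 split_massS0 /q; ring.
rewrite [in LHS]big_ord_recr [in RHS]big_ord_recr [in RHS]mulrDr -{}IHj /=.
by rewrite split_massSS /q; ring.
Qed.

Lemma forms_mass_geometric c r i j :
  forms_mass (fun k => c * r ^+ k) i j = (c * r ^+ i) * (c * r ^+ j).
Proof.
rewrite -[RHS]mulr1 -(split_mass_race i j) mulrDr !(mulrCA _ p) !(mulrCA _ q).
rewrite /forms_mass; congr (_ * _ + _ * _); rewrite big_distrr.
all: apply: eq_bigr => k _.
  have -> : r ^+ i = r ^+ k * r ^+ (i - k) by rewrite -exprD subnKC // -ltnS.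
  by rewrite /= exprD; ring.
have -> : r ^+ j = r ^+ k * r ^+ (j - k) by rewrite -exprD subnKC // -ltnS.
by rewrite /= exprD; ring.
Qed.

(** The indices that occur are [k], [i - k + j] and [i + (j - k)], all at most [i + j]. This
    locality drives the induction in [forms_mass_rank1]. *)
Lemma forms_mass_local f g i j :
  (forall k, (k <= i + j)%N -> f k = g k) -> forms_mass f i j = forms_mass g i j.
Proof.
move=> fg; rewrite /forms_mass.
congr (_ * _ + _ * _); apply: eq_bigr => k _; rewrite !fg //; have := ltn_ord k; lia.
Qed.

(* Row 1 involves the new value [f n.+1] only through the term [f 0 * f n.+1]. *)
Lemma forms_mass1 f g n : (forall k, (k <= n)%N -> f k = g k) -> (0 < n)%N ->
  forms_mass f 1 n - forms_mass g 1 n =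
  g 0%N * split_mass 1 n * (f n.+1 - g n.+1).
Proof.
(* The term [k = 0] of each sum contains [f n.+1], and the weights [p] and [q] add up to 1. By
   [0 < n], the value [f 1] is among those already matched. *)
move=> fg n0; rewrite /forms_mass !big_ord_recl !big_ord0 /= /bump /= !subn0 !subnn.
rewrite !add1n !add0n ![f 0%N]fg // ![f 1%N]fg // ![f n]fg //.
under eq_bigr => k _.
  rewrite !fg; [|have := ltn_ord k; lia..].
  over.
by rewrite /q; ring.
Qed.

Lemma forms_mass_rank1 f :
  p != 0 -> q != 0 -> (forall n, n.+1%:R != 0 :> F) -> f 0%N != 0 ->
  (forall n, forms_mass f 1 n * forms_mass f 0 0 =
             forms_mass f 1 0 * forms_mass f 0 n) ->
  forall k, f k = f 0%N * (f 1%N / f 0%N) ^+ k.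
Proof.
move=> hp hq n_neq0 f0 rk1 k.
set g := (fun k => f 0%N * (f 1%N / f 0%N) ^+ k); rewrite -/(g k).
have g0 : g 0%N = f 0%N by rewrite /g expr0 mulr1.
elim/ltn_ind: k => -[//|[_|n IHn]]; first by rewrite /g expr1 mulrC divfK.
have fg m : (m <= n.+1)%N -> forall k : nat, (k <= m)%N -> f k = g k.
  by move=> mn k km; apply: IHn; lia.
have eqM : forms_mass f 1 n.+1 = forms_mass g 1 n.+1.
  have M00 : forms_mass f 0 0 = forms_mass g 0 0.
    by apply: forms_mass_local; exact: fg.
  have M00_neq0 : forms_mass g 0 0 != 0.
    by rewrite forms_mass_geometric !expr0 !mulr1 mulf_neq0.
  (* The other three entries of the minor use values up to index [n.+1] only, so they agree for [f]
     and [g], and [g] satisfies the same equation. *)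
  apply: (mulIf M00_neq0); rewrite -{1}M00 rk1.
  rewrite !(@forms_mass_local f g); [|by apply: fg; lia..].
  by rewrite !forms_mass_geometric; ring.
have := forms_mass1 (fg _ (leqnn _)) (ltn0Sn n).
rewrite eqM subrr g0 => /esym/eqP; rewrite !mulf_eq0 (negPf f0) /=.
(* The coefficient of the difference, [split_mass 1 n.+1], is [n.+2] times powers of [p] and [q],
   hence nonzero. *)
rewrite bin1 !expf_eq0 (negPf hp) (negPf hq) (negPf (n_neq0 _)) !andbF.
by rewrite subr_eq0 => /eqP.
Qed.

End mass.

(** * Random variables with values in the natural numbers *)

Section nat_valued.
Context d (T : measurableType d) (R : realType) (P : probability T R).

(** On each of the countably many level sets of [N] the composite is a fixed [G n]. This handles
    sums with a random number of terms. *)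
Lemma measurable_fun_nat_subst d' (U : measurableType d') (N : T -> nat)
    (G : nat -> T -> U) :
  measurable_fun setT N -> (forall n, measurable_fun setT (G n)) ->
  measurable_fun setT (fun t => G (N t) t).
Proof.
move=> mN mG _ A mA; rewrite setTI.
have -> : (fun t => G (N t) t) @^-1` A =
    \bigcup_n (N @^-1` [set n] `&` G n @^-1` A).
  apply/seteqP; split => t /=; first by exists (N t).
  by move=> [n _ [/= -> ]].
apply: bigcup_measurable => n _; apply: measurableI.
- by rewrite -[X in measurable X]setTI; exact: mN.
- by rewrite -[X in measurable X]setTI; exact: mG.
Qed.

Lemma measurable_fun_bool_comp (b : T -> bool) (f : bool -> nat) :
  measurable_fun setT b -> measurable_fun setT (f \o b).
Proof. by move=> mb; apply: measurableT_comp mb => _ A _; exact: I. Qed.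

Lemma measurable_fun_sum_bool (b : nat -> T -> bool) n :
  (forall l, measurable_fun setT (b l)) ->
  measurable_fun setT (fun t => \sum_(l < n) b l t)%N.
Proof.
move=> mb; elim: n => [|n IHn].
  under eq_fun do rewrite big_ord0; exact: measurable_cst.
under eq_fun do rewrite big_ord_recr /=.
apply: (measurable_fun_nat_subst (G := fun k t => k + b n t)%N IHn) => k.
exact: (measurable_fun_bool_comp (addn k)).
Qed.

Lemma measurable_nat_preimage (N : T -> nat) (A : set nat) :
  measurable_fun setT N -> measurable (N @^-1` A).
Proof. by move=> mN; rewrite -[X in measurable X]setTI; exact: mN. Qed.

Lemma prob_bigcup_nat (N : T -> nat) (E : set T) (A : set nat) :
  measurable_fun setT N -> measurable E ->
  P (E `&` N @^-1` A) =
  (\sum_(0 <= i <oo | i \in A) P (E `&` N @^-1` [set i]))%E.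
Proof.
move=> mN mE.
have -> : E `&` N @^-1` A = \bigcup_(i in A) (E `&` N @^-1` [set i]).
  apply/seteqP; split => t /=; first by move=> [Et At]; exists (N t).
  by move=> [n An [/= Et Nt]]; rewrite Nt.
rewrite measure_bigcup //.
- by move=> i _; apply: measurableI => //; exact: measurable_nat_preimage.
- by move=> i j _ _ [t [[_ /= <-] [_ /= <-]]].
Qed.

Lemma prob_bounded_nat (N : T -> nat) (E : set T) n :
  measurable_fun setT N -> measurable E -> (forall t, E t -> (N t < n)%N) ->
  P E = (\sum_(k < n) P (E `&` N @^-1` [set k : nat]))%E.
Proof.
move=> mN mE En.
rewrite -(measure_bigsetU P (F := fun k => E `&` N @^-1` [set k])).
- rewrite -(bigcup_mkord n (fun k => E `&` N @^-1` [set k])).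
  congr (P _); apply/seteqP; split => t /=.
    by move=> Et; exists (N t) => //; exact: En.
  by move=> [k _ []].
- by move=> i; apply: measurableI => //; exact: measurable_nat_preimage.
- by move=> i j _ _ [t [[_ /= <-] [_ /= <-]]].
Qed.

Lemma g_sigma_algebra_preimageE d' (U : measurableType d')
    (f : T -> U) (A : set U) :
  measurable A -> g_sigma_algebra_preimage f (f @^-1` A).
Proof. by move=> mA; exists A => //; rewrite setTI. Qed.

Lemma indep_rvE d1 d2 (U : measurableType d1) (V : measurableType d2)
    (f : T -> U) (g : T -> V) (A : set U) (B : set V) :
  indep_rv P f g -> measurable A -> measurable B ->
  P (f @^-1` A `&` g @^-1` B) = (P (f @^-1` A) * P (g @^-1` B))%E.
Proof. by move=> fg mA mB; apply: fg; exact: g_sigma_algebra_preimageE. Qed.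

(** Every event is a countable disjoint union of point events: the product rule is summed over [A]
    with [j] fixed, then over [B]. *)
Lemma indep_rv_nat (M N : T -> nat) :
  measurable_fun setT M -> measurable_fun setT N ->
  (forall i j, P (M @^-1` [set i] `&` N @^-1` [set j]) =
               (P (M @^-1` [set i]) * P (N @^-1` [set j]))%E) ->
  indep_rv P M N.
Proof.
move=> mM mN MN _ _ [A _ <-] [B _ <-]; rewrite !setTI.
have mMA C := measurable_nat_preimage C mM.
have mNA C := measurable_nat_preimage C mN.
have probE K (C : set nat) : measurable_fun setT K ->
    P (K @^-1` C) = (\sum_(0 <= i <oo | i \in C) P (K @^-1` [set i]))%E.
  move=> mK; rewrite -[K @^-1` C]setTI prob_bigcup_nat //.
  by apply: eq_eseriesr => i _; rewrite setTI.
have MA j : P (M @^-1` A `&` N @^-1` [set j]) =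
    (P (M @^-1` A) * P (N @^-1` [set j]))%E.
  rewrite setIC prob_bigcup_nat // muleC.
  have /fineK <- : P (N @^-1` [set j]) \is a fin_num by exact: fin_num_measure.
  rewrite (probE M) // -nneseriesZl //.
  by apply: eq_eseriesr => i _; rewrite setIC MN muleC fineK // fin_num_measure.
rewrite prob_bigcup_nat //.
have /fineK <- : P (M @^-1` A) \is a fin_num by exact: fin_num_measure.
rewrite (probE N B) // -nneseriesZl //.
by apply: eq_eseriesr => j _; rewrite MA fineK // fin_num_measure.
Qed.

End nat_valued.

(** * Sums of independent Bernoulli variables *)

Section bernoulli_sums.
Context d (T : measurableType d) (R : realType) (P : probability T R).

Lemma bernoulli_prob1 (r : R) (b : bool) : 0 <= r <= 1 ->
  bernoulli_prob r [set b] = (bernoulli_pmf r b)%:E.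
Proof.
move=> r01; rewrite bernoulli_probE // !diracE.
by case: b; rewrite !in_set1 /= !(mule0, mule1, adde0, add0e).
Qed.

Variables (e : nat -> {RV P >-> bool}) (r : R).
Hypothesis r01 : 0 <= r <= 1.
Hypothesis e_bernoulli : forall j, is_bernoulli r (e j).
Hypothesis e_indep : indep_sequence P e.

Definition count_true n (t : T) : nat := (\sum_(l < n) e l t)%N.

Definition cylinder n (w : seq bool) : set T :=
  [set t | forall i, (i < size w)%N -> e (n + i)%N t = nth false w i].

Lemma prob_bit j b : P (e j @^-1` [set b]) = (bernoulli_pmf r b)%:E.
Proof. by rewrite -bernoulli_prob1 // -(e_bernoulli j). Qed.

Lemma prob_cylinder n w :
  P (cylinder n w) = (\prod_(b <- w) bernoulli_pmf r b)%:E.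
Proof.
pose J := seq_fset tt (iota n (size w)).
have JE : J =i iota n (size w) by exact: seq_fsetE.
move: J JE => J JE.
have := e_indep J (A := fun j => [set nth false w (j - n)]) (fun=> I).
have -> : \bigcap_(j in [set` J]) e j @^-1` [set nth false w (j - n)] =
    cylinder n w.
  apply/seteqP; split => t /=.
    move=> Jt i iw; rewrite (Jt (n + i)%N) ?addKn //=.
    by rewrite JE mem_iota; lia.
  move=> wt j /=; rewrite JE mem_iota => jn.
  by have := wt (j - n)%N; rewrite subnKC; [apply; lia|lia].
move=> ->; rewrite (perm_big (iota n (size w))) /=; last first.
  by apply: uniq_perm; rewrite ?iota_uniq ?(fset_uniq J).
rewrite -[n in iota n]addn0 iotaDl big_map.
under eq_bigr do rewrite addKn prob_bit.
by rewrite -prodEFin [RHS](big_nth false) /index_iota subn0.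
Qed.

Lemma measurable_cylinder n w : measurable (cylinder n w).
Proof.
have -> : cylinder n w =
    \bigcap_(i in `I_(size w)) e (n + i)%N @^-1` [set nth false w i] by [].
apply: bigcap_measurableType => i _; exact: measurable_funPTI.
Qed.

Lemma measurable_count_true n : measurable_fun setT (count_true n).
Proof. exact: (measurable_fun_sum_bool n (fun l => measurable_funPT (e l))). Qed.

(* Carrying the bits [w] that follow the first [n] makes the induction work with the
   product rule on cylinders only: the step on [n] prepends bit [n] to [w]. *)
Lemma prob_count_true_cylinder n s w :
  P (count_true n @^-1` [set s] `&` cylinder n w) =
  ('C(n, s)%:R * r ^+ s * (1 - r) ^+ (n - s) *
   \prod_(b <- w) bernoulli_pmf r b)%:E.
Proof.
elim: n s w => [|n IHn] s w.
  have -> : count_true 0 @^-1` [set s] = if s == 0%N then setT else set0.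
    apply/seteqP; split => t; rewrite /= /count_true big_ord0; first by move=> <-.
    by case: s.
  case: s => [|s] /=; first by rewrite setTI prob_cylinder bin0 !expr0 !mul1r.
  by rewrite set0I measure0 bin0n !mul0r.
pose E (b : bool) :=
  [set t | (count_true n t + b)%N = s /\ e n t = b /\ cylinder n.+1 w t].
have cylS b t : cylinder n (b :: w) t <-> e n t = b /\ cylinder n.+1 w t.
  split.
    move=> wt; split; first by have := wt 0%N isT; rewrite addn0.
    by move=> i iw; have := wt i.+1 iw; rewrite addnS addSn.
  by move=> [eb wt] [|i] iw /=; [rewrite addn0|rewrite addnS -addSn; exact: wt].
have EE : count_true n.+1 @^-1` [set s] `&` cylinder n.+1 w = E true `|` E false.
  apply/seteqP; split => t; rewrite /E /= /count_true big_ord_recr /=.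
    by case: (e n t) => -[]; [left|right].
  by case=> -[] ? [-> ?].
have Etrue : E true = if s is s'.+1 then
    count_true n @^-1` [set s'] `&` cylinder n (true :: w) else set0.
  rewrite /E; case: (s) => [|s']; apply/seteqP; split => t //=; rewrite ?cylS addn1.
  - by case.
  - by move=> [[->]].
  - by move=> [->].
have Efalse : E false = count_true n @^-1` [set s] `&` cylinder n (false :: w).
  by apply/seteqP; split => t; rewrite /E /= ?cylS addn0.
have mcc k u m : measurable (count_true n @^-1` [set k] `&` cylinder m u).
  apply: measurableI; last exact: measurable_cylinder.
  by apply: measurable_nat_preimage; exact: measurable_count_true.
have -> : P (count_true n.+1 @^-1` [set s] `&` cylinder n.+1 w) =
    (P (E true) + P (E false))%E.
  rewrite EE measureU //; [by rewrite Etrue; case: (s)|by rewrite Efalse|].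
  apply/seteqP; split => t //= -[[_ [et _]] [_ [ef _]]].
  by move: ef; rewrite et.
rewrite Etrue Efalse IHn !big_cons /=.
case: s {EE Etrue Efalse E} => [|s].
  by rewrite measure0 add0e !bin0 !subn0 exprS; congr (_%:E); ring.
rewrite IHn big_cons -EFinD binS natrD subSS /=; congr (_%:E).
(* The exponent [n - s.+1] is truncated when [n <= s], but then its binomial coefficient
   vanishes. *)
have [sn|ns] := ltnP s n; last first.
  by rewrite (bin_small (_ : n < s.+1)%N) // exprS; ring.
by rewrite -(subnSK sn) !exprS; ring.
Qed.

Lemma prob_count_true n s :
  P (count_true n @^-1` [set s]) = ('C(n, s)%:R * r ^+ s * (1 - r) ^+ (n - s))%:E.
Proof.
have := prob_count_true_cylinder n s [::]; rewrite big_nil mulr1 => <-.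
by rewrite (_ : cylinder n [::] = setT) ?setIT //; apply/seteqP; split.
Qed.

Lemma sigma_sequence_count_true n s :
  sigma_sequence e (count_true n @^-1` [set s]).
Proof.
pose G := \bigcup_j g_sigma_algebra_preimage (e j).
pose e' j : g_sigma_algebraType G -> bool := e j.
(* Changing the sigma-algebra on [T] to the one generated by the sequence turns membership into
   measurability of a finite sum. *)
suff : measurable_fun setT (count_true n : g_sigma_algebraType G -> nat).
  by move/measurable_nat_preimage; exact.
have me j : measurable_fun setT (e' j).
  move=> _ A _; rewrite setTI; apply: sub_sigma_algebra; exists j => //.
  exact: g_sigma_algebra_preimageE.
exact: (measurable_fun_sum_bool n me).
Qed.

End bernoulli_sums.

(** * The law of the two forms *)

Lemma thin_success_le {T : Type} (X : T -> nat) (es : nat -> T -> bool) t :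
  (thin_success X es t <= X t)%N.
Proof.
rewrite /thin_success -[leqRHS]card_ord -sum1_card.
by apply: leq_sum => l _; case: (es l t).
Qed.

Lemma thin_failureE {T : Type} (X : T -> nat) (es : nat -> T -> bool) t :
  thin_failure X es t = (X t - thin_success X es t)%N.
Proof.
rewrite -[X t in RHS]card_ord -sum1_card /thin_failure /thin_success -sumnB //.
by move=> l _; case: (es l t).
Qed.

Section forms_law.
Context (R : realType) (d : measure_display) (T : measurableType d)
    (P : probability T R) (X Y : {RV P >-> nat}) (p : R)
    (eps : {RV P >-> bool}) (epsj : nat -> {RV P >-> bool}).
Hypothesis p01 : 0 <= p <= 1.
Hypothesis XY_indep : indep_rv P X Y.
Hypothesis XY_id : identically_distributed X Y.
Hypothesis eps_bernoulli : is_bernoulli p eps.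
Hypothesis eps_indep : indep_rv P eps (fun t => (X t, Y t)).
Hypothesis epsj_bernoulli : forall j, is_bernoulli (1 - p) (epsj j).
Hypothesis epsj_mutual_indep : indep_sequence P epsj.
Hypothesis epsj_indep : indep_systems P (sigma_sequence epsj)
                    (g_sigma_algebra_preimage (fun t => (X t, Y t, eps t))).

Definition pmf (k : nat) : R := fine (P (X @^-1` [set k])).

Lemma pmfE k : P (X @^-1` [set k]) = (pmf k)%:E.
Proof. by rewrite /pmf fineK // fin_num_measure //; exact: measurable_funPTI. Qed.

Lemma pmfYE k : P (Y @^-1` [set k]) = (pmf k)%:E.
Proof. by rewrite -pmfE; have /esym := XY_id [set k]. Qed.

Local Notation L1 := (form1 X Y eps epsj).
Local Notation L2 := (form2 X Y eps epsj).

(** Fixing [X] makes the number of thinning trials deterministic. Independence is then used in three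
    stages: the trials from the triple, [eps] from the pair, [X] from [Y]. *)
Lemma prob_atom s f k b :
  P (count_true epsj (s + f) @^-1` [set s] `&`
     [set t | X t = (s + f)%N /\ Y t = k /\ eps t = b]) =
  (split_mass p s f * (pmf (s + f) * pmf k * bernoulli_pmf p b))%:E.
Proof.
rewrite epsj_indep; last 2 first.
- exact: sigma_sequence_count_true.
- exists [set ((s + f)%N, k, b)].
    rewrite (_ : [set _] = ([set (s + f)%N] `*` [set k]) `*` [set b]).
      by apply: measurableX => //; apply: measurableX.
    by apply/seteqP; split => -[[x y] z] /=; [case=> -> -> ->|case=> -[-> ->] ->].
  by apply/seteqP; split => t /=; [case=> _ [-> -> ->]|case=> -> [-> ->]].
have q01 : 0 <= 1 - p <= 1 by case/andP: p01 => p0 p1; rewrite subr_ge0 p1 gerBl.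
rewrite (prob_count_true q01) //.
have -> : [set t | X t = (s + f)%N /\ Y t = k /\ eps t = b] =
    eps @^-1` [set b] `&` (fun t => (X t, Y t)) @^-1` [set ((s + f)%N, k)].
  by apply/seteqP; split => t /=; [case=> -> [-> ->]|case=> -> [-> ->]].
have mXY : measurable [set ((s + f)%N, k)].
  rewrite (_ : [set _] = [set (s + f)%N] `*` [set k]); first exact: measurableX.
  by apply/seteqP; split => -[x y] /=; [case=> -> ->|case=> -> ->].
rewrite (indep_rvE eps_indep) //.
have -> : (fun t => (X t, Y t)) @^-1` [set ((s + f)%N, k)] =
    X @^-1` [set (s + f)%N] `&` Y @^-1` [set k].
  by apply/seteqP; split => t /=; case=> -> ->.
rewrite (indep_rvE XY_indep) // pmfE pmfYE.
have -> : P (eps @^-1` [set b]) = (bernoulli_pmf p b)%:E.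
  by rewrite -bernoulli_prob1 // -eps_bernoulli.
rewrite -!EFinM /split_mass addKn (_ : 1 - (1 - p) = p); last by ring.
by congr (_%:E); ring.
Qed.

Lemma measurable_form1 : measurable_fun setT L1.
Proof.
have mS : measurable_fun setT (thin_success X epsj).
  exact: (measurable_fun_nat_subst (measurable_funPT X)
    (measurable_count_true epsj)).
(* Freezing the thinned sum and then [Y] leaves a function of the single bit [eps]. *)
apply: (measurable_fun_nat_subst (G := fun s t => s + eps t * Y t)%N mS) => s.
apply: (measurable_fun_nat_subst (G := fun y t => s + eps t * y)%N
  (measurable_funPT Y)) => y.
exact: (measurable_fun_bool_comp (fun b => s + b * y)%N (measurable_funPT eps)).
Qed.

Lemma measurable_form2 : measurable_fun setT L2.
Proof.
have mF : measurable_fun setT (thin_failure X epsj).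
  apply: (measurable_fun_nat_subst
    (G := fun n t => \sum_(l < n) (1 - epsj l t))%N (measurable_funPT X)) => n.
  have negbE (b : bool) : (1 - b)%N = ~~ b by case: b.
  under eq_fun do under eq_bigr do rewrite negbE.
  apply: (measurable_fun_sum_bool n (b := fun l t => ~~ epsj l t)) => l.
  by apply: measurableT_comp (measurable_funPT (epsj l)) => _ A _.
apply: (measurable_fun_nat_subst (G := fun f t => f + (1 - eps t) * Y t)%N mF) => f.
apply: (measurable_fun_nat_subst (G := fun y t => f + (1 - eps t) * y)%N
  (measurable_funPT Y)) => y.
exact: (measurable_fun_bool_comp (fun b : bool => f + (1 - b) * y)%N
  (measurable_funPT eps)).
Qed.

(** Once [eps] and [Y = k] are fixed, the forms determine both thinned sums, hence [X], so each
    piece is an atom of [prob_atom]. The form that receives [Y] bounds [k]: by [i] if [eps] is true,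
    by [j] otherwise. *)
Lemma prob_forms i j :
  P (L1 @^-1` [set i] `&` L2 @^-1` [set j]) = (forms_mass p pmf i j)%:E.
Proof.
pose E := L1 @^-1` [set i] `&` L2 @^-1` [set j].
have mE : measurable E.
  apply: measurableI; apply: measurable_nat_preimage.
    exact: measurable_form1.
  exact: measurable_form2.
have meps b : measurable (eps @^-1` [set b]) by exact: measurable_funPTI.
have -> : P E =
    (P (E `&` eps @^-1` [set true]) + P (E `&` eps @^-1` [set false]))%E.
  rewrite -measureU; [congr (P _)|exact: measurableI..|].
    by apply/seteqP; split => t /=; case: (eps t); tauto.
  by apply/seteqP; split => t //= -[[_ ->] []].
have EP t : E t <-> (thin_success X epsj t + eps t * Y t = i /\
    (X t - thin_success X epsj t) + (1 - eps t) * Y t = j)%N.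
  by rewrite /E /= /form1 /form2 thin_failureE.
(* This bound makes the subtraction in [EP] a genuine one, so that [X] can be recovered from the two
   thinned sums. *)
have SX := thin_success_le X epsj.
have CE t : thin_success X epsj t = count_true epsj (X t) t by [].
rewrite (prob_bounded_nat P (n := i.+1) (measurable_funPT Y)); last 2 first.
- exact: measurableI.
- by move=> t [/EP[]] + _ /= e1; rewrite e1; lia.
rewrite [P (_ `&` eps @^-1` [set false])]
  (prob_bounded_nat P (n := j.+1) (measurable_funPT Y)); last 2 first.
- exact: measurableI.
- by move=> t [/EP[_]] + /= e0; rewrite e0; lia.
rewrite /forms_mass !big_distrr EFinD -!sumEFin.
congr (_ + _)%E; apply: eq_bigr => k _ /=.
  have ki : (k <= i)%N by rewrite -ltnS.
  transitivity (P (count_true epsj (i - k + j) @^-1` [set (i - k)%N] `&`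
     [set t | X t = (i - k + j)%N /\ Y t = k /\ eps t = true])).
    congr (P _); apply/seteqP; split => t /=.
      move=> [[/EP + et] Yk]; rewrite et Yk => -[Si Fj].
      have Xt : X t = (i - k + j)%N by have := SX t; lia.
      by rewrite -{1}Xt; split=> //; rewrite -CE; lia.
    move=> [St [Xt [Yt et]]]; split => //; split => //; apply/EP.
    by rewrite CE Xt Yt et St; lia.
  by rewrite prob_atom /bernoulli_pmf; congr (_%:E); ring.
have kj : (k <= j)%N by rewrite -ltnS.
transitivity (P (count_true epsj (i + (j - k)) @^-1` [set i] `&`
   [set t | X t = (i + (j - k))%N /\ Y t = k /\ eps t = false])).
  congr (P _); apply/seteqP; split => t /=.
    move=> [[/EP + et] Yk]; rewrite et Yk => -[Si Fj].
    have Xt : X t = (i + (j - k))%N by have := SX t; lia.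
    by rewrite -{1}Xt; split=> //; rewrite -CE; lia.
  move=> [St [Xt [Yt et]]]; split => //; split => //; apply/EP.
  by rewrite CE Xt Yt et St; lia.
by rewrite prob_atom /bernoulli_pmf; congr (_%:E); ring.
Qed.

Lemma nneseries_pmf : (\sum_(0 <= k <oo) (pmf k)%:E = 1)%E.
Proof.
rewrite -(probability_setT P) -[in RHS](setTI setT) -(preimage_setT X).
rewrite prob_bigcup_nat; [|exact: measurable_funPT|exact: measurableT].
rewrite [RHS](eq_eseriesl (Q := xpredT)); last by move=> k; rewrite in_setT.
by apply: eq_eseriesr => k _; rewrite setTI pmfE.
Qed.

Lemma pmf_ge0 k : 0 <= pmf k.
Proof. exact: fine_ge0. Qed.

Lemma cvg_series_pmf : series pmf n @[n --> \oo] --> (1 : R).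
Proof.
have : (\sum_(0 <= k < n) (pmf k)%:E)%E @[n --> \oo] --> 1%E.
  rewrite -nneseries_pmf; apply: is_cvg_nneseries => k _ _.
  by rewrite lee_fin pmf_ge0.
move=> /fine_cvgP[_]; apply: cvg_trans; apply: near_eq_cvg.
by near=> n; rewrite /= sumEFin.
Unshelve. all: end_near. Qed.

Lemma indep_forms_geometric c r : (forall k, pmf k = c * r ^+ k) ->
  indep_rv P L1 L2.
Proof.
move=> pmf_geo.
have joint i j : P (L1 @^-1` [set i] `&` L2 @^-1` [set j]) =
    ((pmf i)%:E * (pmf j)%:E)%E.
  rewrite prob_forms -EFinM !pmf_geo -(forms_mass_geometric p c r i j).
  by congr (_%:E); apply: forms_mass_local => k _.
have mL1 i : measurable (L1 @^-1` [set i]).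
  exact/measurable_nat_preimage/measurable_form1.
have mL2 j : measurable (L2 @^-1` [set j]).
  exact/measurable_nat_preimage/measurable_form2.
(* Since [pmf] sums to 1, summing out one coordinate of the joint law shows that each form has the
   law of [X]. *)
have marginal (M : T -> nat) (E : set T) k : measurable_fun setT M ->
    measurable E ->
    (forall i, P (E `&` M @^-1` [set i]) = ((pmf k)%:E * (pmf i)%:E)%E) ->
    P E = (pmf k)%:E.
  move=> mM mE EM; rewrite -[E]setIT -(preimage_setT M) prob_bigcup_nat //.
  rewrite (eq_eseriesl (Q := xpredT)); last by move=> i; rewrite in_setT.
  under eq_eseriesr do rewrite EM.
  rewrite nneseriesZl; last by move=> i _; rewrite lee_fin pmf_ge0.
  by rewrite nneseries_pmf mule1.
apply: indep_rv_nat => [||i j]; [exact: measurable_form1|exact: measurable_form2|].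
rewrite joint (marginal L2 (L1 @^-1` [set i]) i) //; last exact: measurable_form2.
rewrite (marginal L1 (L2 @^-1` [set j]) j) //; first exact: measurable_form1.
by move=> k; rewrite setIC joint muleC.
Qed.

(** Both sides are the product of the same four marginal probabilities. Expressing rank one by
    minors keeps the unknown marginals out of the equations. *)
Lemma forms_mass_minors i j k l : indep_rv P L1 L2 ->
  forms_mass p pmf i j * forms_mass p pmf k l =
  forms_mass p pmf i l * forms_mass p pmf k j.
Proof.
move=> L12; apply: EFin_inj; rewrite !EFinM -!prob_forms.
rewrite !(indep_rvE L12) // muleACA [RHS]muleACA; congr (_ * _)%E.
by rewrite muleC.
Qed.

End forms_law.

(** * Normalisation of a geometric sequence, and positivity of the joint mass on the axes *)

Lemma cvg_series_geometric1 (R : realType) (c r : R) : 0 < c -> 0 <= r ->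
  series (geometric c r) n @[n --> \oo] --> (1 : R) -> r < 1 /\ c = 1 - r.
Proof.
move=> c0 r0 cvg1; have r1 : r < 1.
  rewrite ltNge; apply/negP => r1.
  (* The tolerance is [c] itself: for [1 <= r] no term falls below [c], so the terms cannot tend to
     0. *)
  have /cvgrPdist_lt /(_ c c0) [N _ /(_ N (leqnn _))] :=
    cvg_series_cvg_0 (cvgP _ cvg1).
  rewrite /= sub0r normrN ger0_norm ?mulr_ge0 ?exprn_ge0 ?(ltW c0) //.
  by rewrite ltNge ler_peMr ?exprn_ege1 // ltW.
have r_lt1 : `|r| < 1 by rewrite ger0_norm.
split=> //; have e : 1 = c / (1 - r).
  exact: (cvg_unique _ cvg1 (cvg_geometric_series r_lt1)).
by rewrite -[LHS](@divfK _ (1 - r)) -?e ?mul1r // subr_eq0 gt_eqF.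
Qed.

Lemma sumr_gt0_witness (R : numDomainType) (I : finType) (F : I -> R) i :
  (forall k, 0 <= F k) -> 0 < F i -> 0 < \sum_k F k.
Proof.
by move=> F0 Fi; rewrite (bigD1 i) //=; apply: ltr_pwDl => //; exact: sumr_ge0.
Qed.

(** The positive term is [k = m]: both variables equal [m], and all of [X] is thinned into the
    coordinate that receives [Y]. *)
Lemma forms_mass_axes_gt0 (R : numFieldType) (p : R) (f : nat -> R) m :
  0 < p -> 0 < 1 - p -> (forall k, 0 <= f k) -> 0 < f m ->
  0 < forms_mass p f (m + m) 0 /\ 0 < forms_mass p f 0 (m + m).
Proof.
move=> p0 q0 f0 fm.
have mm : (m < (m + m).+1)%N by rewrite ltnS leq_addr.
have split_ge0 i j : 0 <= split_mass p i j.
  by rewrite /split_mass !mulr_ge0 ?exprn_ge0 ?(ltW p0) ?(ltW q0).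
have term_ge0 i j k l : 0 <= f i * f j * split_mass p k l.
  by apply: (mulr_ge0 _ (split_ge0 k l)); exact: mulr_ge0.
rewrite /forms_mass; split; [apply: ltr_pwDl|apply: ltr_wpDl].
- apply: mulr_gt0 => //; apply: (sumr_gt0_witness (i := Ordinal mm)) => [k|/=].
    exact: term_ge0.
  rewrite addn0 addnK; apply: (mulr_gt0 (mulr_gt0 fm fm)).
  by rewrite /split_mass addn0 binn mulr1 mul1r exprn_gt0.
- by rewrite mulr_ge0 ?sumr_ge0 ?(ltW p0) ?(ltW q0) // => k _; exact: term_ge0.
- by rewrite mulr_ge0 ?sumr_ge0 ?(ltW p0) ?(ltW q0) // => k _; exact: term_ge0.
- apply: mulr_gt0 => //; apply: (sumr_gt0_witness (i := Ordinal mm)) => [k|/=].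
    exact: term_ge0.
  rewrite add0n addnK; apply: (mulr_gt0 (mulr_gt0 fm fm)).
  by rewrite split_mass0 exprn_gt0.
Qed.

Theorem theorem2p1 (R : realType) (d : measure_display) (T : measurableType d)
    (P : probability T R) (X Y : {RV P >-> nat}) (p : R)
    (eps : {RV P >-> bool}) (epsj : nat -> {RV P >-> bool})
    (p_gt0 : 0 < p) (p_lt1 : p < 1)
    (XY_indep : indep_rv P X Y)
    (XY_id : identically_distributed X Y)
    (* The case X = 0 a.s. (the limit a -> +oo) is excluded: there L1 = L2 = 0 a.s.
       are independent, but X is not geometric with a finite a > 1. *)
    (X_nondegenerate : P (X @^-1` [set 0%N]) != 1%E)
    (eps_bernoulli : is_bernoulli p eps)
    (eps_indep : indep_rv P eps (fun t => (X t, Y t)))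
    (epsj_bernoulli : forall j, is_bernoulli (1 - p) (epsj j))
    (epsj_mutual_indep : indep_sequence P epsj)
    (epsj_indep : indep_systems P (sigma_sequence epsj)
                    (g_sigma_algebra_preimage (fun t => (X t, Y t, eps t)))) :
  indep_rv P (form1 X Y eps epsj) (form2 X Y eps epsj) <-> is_geometric X.
Proof.
have p01 : 0 <= p <= 1 by rewrite !ltW.
have q_gt0 : 0 < 1 - p by rewrite subr_gt0.
split=> [L12|[a a1 Xa]]; last first.
  apply: (indep_forms_geometric p01 XY_indep XY_id eps_bernoulli eps_indep
    epsj_bernoulli epsj_mutual_indep epsj_indep
    (c := (a - 1) / a) (r := a^-1)) => k.
  by rewrite exprVn; apply: EFin_inj; rewrite -pmfE -Xa.
have minor := forms_mass_minors p01 XY_indep XY_id eps_bernoulli eps_indep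
  epsj_bernoulli epsj_mutual_indep epsj_indep _ _ _ _ L12.
have pmf0 : 0 < pmf X 0.
  rewrite lt_neqAle pmf_ge0 andbT; apply/negP => /eqP pmf0.
  have [m pmfm] : exists m, 0 < pmf X m.
    apply: contrapT => /forallNP pmf_le0.
    have := nneseries_pmf X; rewrite eseries0 => [/eqP|k _ _].
      by rewrite eqe eq_sym oner_eq0.
    congr (_%:E); apply/eqP; rewrite eq_le pmf_ge0 leNgt andbT.
    exact/negP/pmf_le0.
  have [] := forms_mass_axes_gt0 p_gt0 q_gt0 (pmf_ge0 X) pmfm.
  (* The minor exchanges the two axis entries for the diagonal ones, and the entry at the origin has
     the factor [pmf X 0]. *)
  move=> /mulr_gt0/[apply]; rewrite minor [X in _ * X]/forms_mass !big_ord1.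
  by rewrite -pmf0 !(mul0r, mulr0, addr0) ltxx.
have geo := forms_mass_rank1 (lt0r_neq0 p_gt0) (lt0r_neq0 q_gt0) _
  (lt0r_neq0 pmf0) (fun n => minor _ _ _ _).
set c := pmf X 0 in pmf0 geo; set r := pmf X 1 / c in geo.
have r0 : 0 <= r by rewrite divr_ge0 ?pmf_ge0.
have [|r1 cE] := cvg_series_geometric1 pmf0 r0.
  rewrite (_ : geometric c r = pmf X); first exact: cvg_series_pmf.
  by apply/funext => k; rewrite geo // => n; rewrite pnatr_eq0.
(* If [r] were 0, then [c = 1 - r] would put all the mass at 0, which nondegeneracy forbids. *)
have r_gt0 : 0 < r.
  rewrite lt_neqAle r0 andbT; apply: contra X_nondegenerate => /eqP r_eq0.
  by rewrite pmfE -/c cE -r_eq0 subr0.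
(* With [a = r^-1] the leading factor [(a - 1) / a] equals [1 - r], which is [c]. *)
exists r^-1; first by rewrite invf_gt1.
move=> k; rewrite [LHS]pmfE geo; last by move=> n; rewrite pnatr_eq0.
rewrite -/c -/r {1}cE; congr (_%:E); rewrite -exprVn invrK; congr (_ * _).
by field; rewrite gt_eqF.
Qed.
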